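(* One has $$6\sum_{n=-\infty}^{\infty} n\,q^{3\binom{n}{2}+2n}=(q ; q)_{\infty}^3 \left(q ; q^2\right)_{\infty}^2-(-q;q^3)_\infty\,(-q^2;q^3)_\infty\,(q^3; q^3)_{\infty}.$$
   Context: $q$ is a complex number with $0<|q|<1$. For $|p|<1$, $(a;p)_\infty=\prod_{j=0}^{\infty}(1-ap^j)$. For every integer $n$ (including negative ones), $\binom{n}{2}=n(n-1)/2$. *)

(* Defs.v *)
From HB Require Import structures.
From mathcomp Require Import all_boot all_order all_algebra.
From mathcomp Require Import complex.
From mathcomp Require Import all_classical all_reals all_analysis.

Set Implicit Arguments.
Unset Strict Implicit.
Unset Printing Implicit Defensive.

Import Order.TTheory GRing.Theory Num.Theory.
Import numFieldNormedType.Exports.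

Local Open Scope classical_set_scope.
Local Open Scope ring_scope.
Local Open Scope complex_scope.

(* R[i] seen as a numClosedFieldType: this is what triggers the inference of
   the norm topology of numFieldNormedType, which R[i] itself does not carry.
   The norm `|z| is the modulus, as an element of R[i]; for x, y : R[i], x < y
   holds when y - x is a positive real. *)
Definition CC (R : realType) : numClosedFieldType := R[i].

(* (a; p)_oo; the limit is the library's total one, meaningful for `|p| < 1. *)
Definition qpoch (R : realType) (a p : CC R) : CC R :=
  \big[*%R/1]_(0 <= j <oo) (1 - a * p ^+ j).

(* The numerator is even, so the Euclidean quotient of intdiv is exact. *)
Definition binz2 (n : int) : int := (n * (n - 1) %/ 2)%Z.

Definition bisummable (R : realType) (f : int -> CC R) : Prop :=
  cvgn (series (fun k : nat => f k%:Z)) /\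
  cvgn (series (fun k : nat => f (- k.+1%:Z))).

Definition bisum (R : realType) (f : int -> CC R) : CC R :=
  limn (series (fun k : nat => f k%:Z)) +
  limn (series (fun k : nat => f (- k.+1%:Z))).

(* Main.v *)
(* Jacobi's triple product and his series for the cube of (q; q)_oo evaluate
     \sum_(m, n) (-1)^(m + n) (2 m - 1 - 4 n) q^(m (m - 1) / 2 + n^2)
   as -2 (q; q)_oo^3 (q; q^2)_oo^2 (q^2; q^2)_oo. Splitting the same absolutely
   convergent sum by m + n mod 3 gives -2 S \sum_v (-1)^v q^(v (3 v + 1)) with
   S = \sum_u (6 u + 1) q^(u (3 u + 1) / 2), and the sum over v is
   (q^2; q^2)_oo. Cancelling this factor evaluates S, and the triple product
   evaluates S - 6 \sum_u u q^(u (3 u + 1) / 2). *)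
Require Import Defs.
From HB Require Import structures.
From mathcomp Require Import all_boot all_order all_algebra finmap.
From mathcomp Require Import complex zify ring.
From mathcomp Require Import all_classical all_reals all_analysis.
Set Implicit Arguments.
Unset Strict Implicit.
Unset Printing Implicit Defensive.
Import Order.TTheory GRing.Theory Num.Theory.
Import numFieldNormedType.Exports.
Local Open Scope ring_scope.

(** The series over Z and Z^2 are shifted, reflected, multiplied and cut into classes, hence the
    unconditional sums over finite sets; [tight_bisum] is the bridge to the one-sided limits of
    [bisum]. The quadratic form dictates the split. With M = 2 m - 1 the exponent is (M^2 + 8 n^2 -
    1) / 8; putting M = 4 v + 2 u + 1 and n = v - u gives M^2 + 8 n^2 = 12 u^2 + 4 u + 24 v^2 + 8 v
    + 1, with no cross term, and the weight M - 4 n becomes 6 u + 1, free of v. The part of the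
    weight in n costs nothing: it multiplies the sum of (-1)^m q^(m (m - 1) / 2), which is 0. Both
    Jacobi identities are limits of finite q-binomial expansions under a dominated convergence
    theorem. The cube is not obtained by differentiating in z: the recurrence is weighted by k at z
    = -1, where it closes into a product. Domination needs (p; p)_n bounded above and away from 0,
    and the lower bound also gives the nonvanishing that permits the final cancellation. *)

(** * Unconditional summation over an arbitrary index type *)

Section UnconditionalSums.
Variable K : numFieldType.

(* Absolute summability, as smallness of all finite sums avoiding a finite set. *)
Definition tight (T : choiceType) (f : T -> K) : Prop :=
  forall e : K, 0 < e -> exists A0 : {fset T}, forall B : {fset T},
    (forall x, x \in B -> x \notin A0) -> \sum_(x <- B) `|f x| <= e.

(** Tightness is recorded beside convergence so that products, reindexing and domination get a
    uniform bound on absolute tails directly. *)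
Definition has_sum (T : choiceType) (f : T -> K) (s : K) : Prop :=
  tight f /\ forall e : K, 0 < e -> exists A0 : {fset T},
    forall A : {fset T}, (A0 `<=` A)%fset -> `|\sum_(x <- A) f x - s| <= e.

Lemma fsumD (T : choiceType) (f : T -> K) (A0 A : {fset T}) :
  (A0 `<=` A)%fset ->
  \sum_(x <- A) f x = \sum_(x <- A0) f x + \sum_(x <- (A `\` A0)%fset) f x.
Proof.
move=> sub; rewrite (big_fsetID _ (fun x => x \in A0)) /=; congr (_ + _).
- apply: eq_fbigl => x; rewrite !inE /=; case: (boolP (x \in A0)) => h.
    by rewrite (fsubsetP sub).
  by rewrite andbF.
- by apply: eq_fbigl => x; rewrite !inE /= andbC.
Qed.

Lemma ler_fsum (T : choiceType) (f : T -> K) (A B : {fset T}) :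
  (forall x, 0 <= f x) -> (A `<=` B)%fset ->
  \sum_(x <- A) f x <= \sum_(x <- B) f x.
Proof. by move=> f0 sub; rewrite (fsumD _ sub) lerDl sumr_ge0. Qed.

Lemma ler_addgt0 (x y : K) : (forall e, 0 < e -> x <= y + e) -> x <= y.
Proof. by move=> h; apply/ler_addgt0Pr. Qed.

(** Enlarging [A] until its sum is near [s] only adds points outside [A0]. The set [A0] thus depends
    on the tail bound alone and can serve a whole family of sums at once. *)
Lemma has_sum_tail (T : choiceType) (f : T -> K) s e (A0 A : {fset T}) :
  has_sum f s ->
  (forall B : {fset T}, (forall x, x \in B -> x \notin A0) ->
     \sum_(x <- B) `|f x| <= e) ->
  (A0 `<=` A)%fset -> `|\sum_(x <- A) f x - s| <= e.
Proof.
move=> [_ hs] hA0 sub; apply: ler_addgt0 => d d0.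
have [A1 hA1] := hs d d0.
have sub1 : (A `<=` A `|` A1)%fset by exact: fsubsetUl.
have := hA1 _ (fsubsetUr A A1).
rewrite (fsumD _ sub1) => h.
rewrite -[X in `|X|](subrK (\sum_(x <- ((A `|` A1) `\` A)%fset) f x)).
set t := \sum_(x <- ((A `|` A1) `\` A)%fset) f x in h *.
have ht : `|t| <= e.
  apply: (le_trans (ler_norm_sum _ _ _)); apply: hA0 => x.
  rewrite !inE => /andP[xA _]; apply: contra xA; exact: (fsubsetP sub).
have -> : \sum_(x <- A) f x - s - t + t =
          (\sum_(x <- A) f x + t - s) + - t by ring.
by rewrite (le_trans (ler_normD _ _)) // normrN addrC lerD.
Qed.

Lemma has_sum_unique (T : choiceType) (f : T -> K) s t :
  has_sum f s -> has_sum f t -> s = t.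
Proof.
move=> [_ hs] [_ ht]; apply/eqP; rewrite -subr_eq0 -normr_le0.
apply: ler_addgt0 => e e0; rewrite add0r.
have e20 : 0 < e / 2 by rewrite divr_gt0.
have [A hA] := hs _ e20; have [B hB] := ht _ e20.
have hA' := hA _ (fsubsetUl A B); have hB' := hB _ (fsubsetUr A B).
rewrite [e](splitr e) -(subrKA (\sum_(x <- (A `|` B)%fset) f x)).
by rewrite (le_trans (ler_normD _ _)) // lerD // distrC.
Qed.

Lemma eq_has_sum (T : choiceType) (f g : T -> K) s :
  f =1 g -> has_sum f s -> has_sum g s.
Proof. by move=> /funext ->. Qed.

Lemma tight_le (T : choiceType) (f g : T -> K) (c : K) : 0 < c ->
  (forall x, `|g x| <= c * `|f x|) -> tight f -> tight g.
Proof.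
move=> c0 hle hf e e0; have [|A hA] := hf (e / c); first by rewrite divr_gt0.
exists A => B hB; apply: (le_trans (ler_sum _ (fun x _ => hle x))).
rewrite -mulr_sumr -ler_pdivlMl // mulrC; exact: hA.
Qed.

Lemma tightD (T : choiceType) (f g : T -> K) :
  tight f -> tight g -> tight (fun x => f x + g x).
Proof.
move=> hf hg e e0; have e20 : 0 < e / 2 by rewrite divr_gt0.
have [A hA] := hf _ e20; have [B hB] := hg _ e20.
exists (A `|` B)%fset => C hC.
apply: (le_trans (ler_sum _ (fun x _ => ler_normD (f x) (g x)))).
rewrite big_split /= [e](splitr e) lerD //.
- by apply: hA => x /hC; rewrite inE negb_or => /andP[].
- by apply: hB => x /hC; rewrite inE negb_or => /andP[].
Qed.

Lemma has_sumD (T : choiceType) (f g : T -> K) s t :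
  has_sum f s -> has_sum g t -> has_sum (fun x => f x + g x) (s + t).
Proof.
move=> [tf hs] [tg ht]; split; first exact: tightD.
move=> e e0; have e20 : 0 < e / 2 by rewrite divr_gt0.
have [A hA] := hs _ e20; have [B hB] := ht _ e20.
exists (A `|` B)%fset => C; rewrite fsubUset => /andP[hAC hBC].
rewrite big_split /= opprD addrACA [e](splitr e).
by rewrite (le_trans (ler_normD _ _)) // lerD // ?hA ?hB.
Qed.

Lemma has_sumZ (T : choiceType) (f : T -> K) c s :
  has_sum f s -> has_sum (fun x => c * f x) (c * s).
Proof.
move=> [tf hs]; have c10 : 0 < `|c| + 1 by rewrite ltr_wpDl.
split.
  apply: (@tight_le _ f _ (`|c| + 1)) => // x.
  by rewrite normrM ler_wpM2r // lerDl.
move=> e e0; have [|A hA] := hs (e / (`|c| + 1)); first by rewrite divr_gt0.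
exists A => B /hA; rewrite -mulr_sumr -mulrBr normrM ler_pdivlMr // mulrC.
by apply: le_trans; rewrite ler_wpM2r // lerDl.
Qed.

Lemma has_sumN (T : choiceType) (f : T -> K) s :
  has_sum f s -> has_sum (fun x => - f x) (- s).
Proof.
move=> /(has_sumZ (-1)); rewrite mulN1r; apply: eq_has_sum => x.
by rewrite mulN1r.
Qed.

Lemma has_sum0 (T : choiceType) : has_sum (fun _ : T => 0) 0.
Proof.
split=> e e0; exists fset0 => B _.
  by rewrite big1 ?ltW // => x _; rewrite normr0.
by rewrite big1 ?subr0 ?normr0 ?ltW.
Qed.

Lemma has_sum_delta (T : choiceType) (a : T) c :
  has_sum (fun x => if x == a then c else 0) c.
Proof.
split=> e e0; exists [fset a]%fset => B hB.
  rewrite big_seq big1 ?ltW // => x /hB; rewrite inE => /negPf ->.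
  by rewrite normr0.
rewrite (fsumD _ hB) big_seq_fset1 eqxx big_seq big1 ?addr0 ?subrr ?normr0 ?ltW //.
by move=> x; rewrite !inE => /andP[/negPf ->].
Qed.

Lemma fsum_image (T U : choiceType) (h : U -> T) (f : T -> K) (A : {fset U}) :
  injective h -> \sum_(x <- (h @` A)%fset) f x = \sum_(u <- A) f (h u).
Proof. by move=> hi; rewrite big_imfset //= => u v _ _; exact: hi. Qed.

Lemma tight_inj (T U : choiceType) (h : U -> T) (f : T -> K) :
  injective h -> tight f -> tight (f \o h).
Proof.
move=> hi tf e e0; have [A hA] := tf e e0.
(* [h] is only injective, so the finite preimage of [A] is built by removing one value of [h] at a
   time. *)
have [A' hA'] : exists A' : {fset U}, forall u, h u \in A -> u \in A'.
  elim/finmap.finSet_rect: A {hA} => A IH.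
  case: (pselect (exists u, h u \in A)) => [[u hu]|hn]; last first.
    by exists fset0 => u hu; case: hn; exists u.
  have [|A' hA'] := IH (A `\ h u)%fset; first by rewrite fproperD1.
  exists (u |` A')%fset => v hv; rewrite !inE.
  by have [//|vu] := eqVneq v u; rewrite hA' // !inE hv andbT (inj_eq hi).
exists A' => B hB; rewrite -(fsum_image (fun x => `|f x|)) //; apply: hA.
move=> x /imfsetP[u /= uB ->]; apply: contra (hB _ uB); exact: hA'.
Qed.

Lemma has_sum_reindex (T U : choiceType) (h : U -> T) (g : T -> U)
    (f : T -> K) s : cancel h g -> cancel g h ->
  has_sum f s -> has_sum (f \o h) s.
Proof.
move=> hK gK [tf hs]; split; first exact: tight_inj (can_inj hK) tf.
move=> e e0; have [A hA] := hs e e0.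
exists (g @` A)%fset => B hB; rewrite -(fsum_image f) ?(can_inj hK) //.
  apply: hA; apply/fsubsetP => x xA; apply/imfsetP; exists (g x) => //=.
  by apply: (fsubsetP hB); rewrite in_imfset.
exact: can_inj hK.
Qed.

Lemma tight_bounded (T : choiceType) (f : T -> K) : tight f ->
  exists2 M : K, 0 < M & forall A : {fset T}, \sum_(x <- A) `|f x| <= M.
Proof.
move=> /(_ 1 ltr01)[A hA]; exists (\sum_(x <- A) `|f x| + 1).
  by rewrite ltr_wpDl // sumr_ge0.
move=> B; rewrite (@le_trans _ _ (\sum_(x <- (A `|` B)%fset) `|f x|)) //.
  by apply: ler_fsum => //; exact: fsubsetUr.
rewrite (fsumD _ (fsubsetUl A B)) lerD2l; apply: hA => x.
by rewrite !inE => /andP[].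
Qed.

Lemma fset_sumP (T U : choiceType) (A : {fset T + U}) :
  exists (A1 : {fset T}) (A2 : {fset U}),
  [/\ forall g : T + U -> K, \sum_(x <- A) g x =
       \sum_(x <- A1) g (inl x) + \sum_(x <- A2) g (inr x),
    forall x, (x \in A1) = (inl x \in A) & forall x, (x \in A2) = (inr x \in A)].
Proof.
have injl : injective (@inl T U) by move=> ? ? [].
have injr : injective (@inr T U) by move=> ? ? [].
exists [fset x in pmap (fun z => if z is inl x then Some x else None) A]%fset.
exists [fset x in pmap (fun z => if z is inr x then Some x else None) A]%fset.
split=> [g|x|x].
- rewrite (big_fsetID _ (fun z => if z is inl _ then true else false)) /=.
  rewrite -(fsum_image _ _ injl) -(fsum_image _ _ injr).
  congr (_ + _); apply: eq_fbigl => -[x|x]; rewrite !inE /= ?andbT ?andbF.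
  + apply/idP/imfsetP => [xA|[y /= + [->]]].
      by exists x => //=; rewrite inE mem_pmap; apply/mapP; exists (inl x).
    by rewrite inE mem_pmap => /mapP[[z|z]//= zA [->]].
  + by apply/esym/negbTE/negP => /imfsetP[].
  + by apply/esym/negbTE/negP => /imfsetP[].
  + apply/idP/imfsetP => [xA|[y /= + [->]]].
      by exists x => //=; rewrite inE mem_pmap; apply/mapP; exists (inr x).
    by rewrite inE mem_pmap => /mapP[[z|z]//= zA [->]].
- rewrite inE mem_pmap; apply/mapP/idP => [[[z|z]//= zA [->]]//|xA].
  by exists (inl x).
- rewrite inE mem_pmap; apply/mapP/idP => [[[z|z]//= zA [->]]//|xA].
  by exists (inr x).
Qed.

Lemma tight_sum (T U : choiceType) (f : T + U -> K) :
  tight (f \o inl) -> tight (f \o inr) -> tight f.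
Proof.
have injl : injective (@inl T U) by move=> ? ? [].
have injr : injective (@inr T U) by move=> ? ? [].
move=> tf tg e e0; have e20 : 0 < e / 2 by rewrite divr_gt0.
  have [A hA] := tf _ e20; have [B hB] := tg _ e20.
  exists ((inl @` A) `|` (inr @` B))%fset => C hC.
  have [C1 [C2 [-> h1 h2]]] := fset_sumP C; rewrite [e](splitr e) lerD //.
  + apply: (hA C1) => x; rewrite h1 => /hC; rewrite inE negb_or => /andP[+ _].
    by rewrite mem_imfset.
  + apply: (hB C2) => x; rewrite h2 => /hC; rewrite inE negb_or => /andP[_].
    by rewrite mem_imfset.
Qed.

Lemma has_sum_sum (T U : choiceType) (f : T + U -> K) s t :
  has_sum (f \o inl) s -> has_sum (f \o inr) t -> has_sum f (s + t).
Proof.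
have injl : injective (@inl T U) by move=> ? ? [].
have injr : injective (@inr T U) by move=> ? ? [].
move=> [tf hs] [tg ht]; split; first exact: tight_sum.
move=> e e0; have e20 : 0 < e / 2 by rewrite divr_gt0.
  have [A hA] := hs _ e20; have [B hB] := ht _ e20.
  exists ((inl @` A) `|` (inr @` B))%fset => C /fsubsetP hC.
  have [C1 [C2 [-> h1 h2]]] := fset_sumP C; rewrite opprD addrACA [e](splitr e).
  rewrite (le_trans (ler_normD _ _)) // lerD //.
  + apply: (hA C1); apply/fsubsetP => x xA; rewrite h1 hC // inE.
    by rewrite mem_imfset // xA.
  + apply: (hB C2); apply/fsubsetP => x xA; rewrite h2 hC // inE orbC.
    by rewrite mem_imfset // xA.
Qed.

Lemma has_sum_prod (T U : choiceType) (f : T -> K) (g : U -> K) s t :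
  has_sum f s -> has_sum g t ->
  has_sum (fun x : T * U => f x.1 * g x.2) (s * t).
Proof.
move=> hf hg; have [tf _] := hf; have [tg _] := hg.
have [M M0 hM] := tight_bounded tf; have [N N0 hN] := tight_bounded tg.
have tail (a b : K) (A : {fset T}) (B : {fset U}) : 0 < a -> 0 < b ->
   (forall B : {fset T}, (forall x, x \in B -> x \notin A) ->
     \sum_(x <- B) `|f x| <= a) ->
   (forall C : {fset U}, (forall x, x \in C -> x \notin B) ->
     \sum_(x <- C) `|g x| <= b) ->
   forall C : {fset T * U}, (forall x, x \in C -> x \notin (A `*` B)%fset) ->
   \sum_(x <- C) `|f x.1 * g x.2| <= a * N + M * b.
  move=> a0 b0 hA hB C hC.
  pose X := (fst @` C)%fset; pose Y := (snd @` C)%fset.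
  pose X' := (X `\` A)%fset; pose Y' := (Y `\` B)%fset.
  have prodE (P : {fset T}) (Q : {fset U}) :
      \sum_(x <- (P `*` Q)%fset) `|f x.1 * g x.2| =
      (\sum_(x <- P) `|f x|) * (\sum_(y <- Q) `|g y|).
    rewrite big_imfset2 /=; last by move=> [? ?] [? ?] _ _ [-> ->].
    rewrite mulr_suml; apply: eq_bigr => x _; rewrite mulr_sumr.
    by apply: eq_bigr => y _; rewrite normrM.
  (* A pair outside the rectangle [A] x [B] has its first entry outside [A] or its second outside
     [B], so two rectangles cover [C]. *)
  rewrite (@le_trans _ _ (\sum_(x <- ((X' `*` Y) `|` (X `*` Y'))%fset)
      `|f x.1 * g x.2|)) //.
    apply: ler_fsum => //; apply/fsubsetP => -[x y] xyC.
    have xX : x \in X by apply/imfsetP; exists (x, y).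
    have yY : y \in Y by apply/imfsetP; exists (x, y).
    have := hC _ xyC; rewrite !inE /= xX yY !andbT /= negb_and.
    by case/orP => ->; rewrite ?orbT.
  rewrite (fsumD _ (fsubsetUl _ _)) lerD //.
    by rewrite prodE ler_pM ?sumr_ge0 ?hN // hA // => x; rewrite inE => /andP[].
  rewrite (@le_trans _ _ (\sum_(x <- (X `*` Y')%fset) `|f x.1 * g x.2|)) //.
    apply: ler_fsum => //; apply/fsubsetP => x; rewrite inE in_fsetU.
    by move=> /andP[/negPf ->].
  by rewrite prodE ler_pM ?sumr_ge0 ?hM // hB // => x; rewrite inE => /andP[].
split.
- move=> e e0.
  have a0 : 0 < e / 2 / N by rewrite !divr_gt0.
  have b0 : 0 < e / 2 / M by rewrite !divr_gt0.
  have [A hA] := tf _ a0; have [B hB] := tg _ b0.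
  exists (A `*` B)%fset => C hC; apply: le_trans (tail _ _ _ _ a0 b0 hA hB _ hC) _.
  rewrite [leLHS](_ : _ = e) //.
  by field; rewrite !gt_eqF.
- move=> e e0; pose c := `|s| + N.
  have c0 : 0 < c by rewrite ltr_wpDl.
  (* The total error is three times e/4: one from the tail of f in [r], one from (u - s) v, and one
     shared by the tail of g in [r] (factor [M]) and by s (v - t) (factor [|s|]), hence the
     denominator [M + |s|]. *)
  have e40 : 0 < e / 2 / 2 by rewrite !divr_gt0.
  have a0 : 0 < e / 2 / 2 / N by rewrite !divr_gt0.
  have b0 : 0 < e / 2 / 2 / (M + `|s|) by rewrite !divr_gt0 // ltr_wpDr.
  have [A hA] := tf _ a0; have [B hB] := tg _ b0.
  exists (A `*` B)%fset => C hC; rewrite (fsumD _ hC).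
  have h1 : `|\sum_(x <- (C `\` (A `*` B))%fset) f x.1 * g x.2| <=
     e / 2 / 2 / N * N + M * (e / 2 / 2 / (M + `|s|)).
    apply: le_trans (ler_norm_sum _ _ _) _; apply: tail hA hB _ _ => // x.
    by rewrite !inE => /andP[].
  have fA := has_sum_tail hf hA (fsubset_refl _).
  have gB := has_sum_tail hg hB (fsubset_refl _).
  have -> : \sum_(x <- (A `*` B)%fset) f x.1 * g x.2 =
      (\sum_(x <- A) f x) * (\sum_(y <- B) g y).
    rewrite big_imfset2 /=; last by move=> [? ?] [? ?] _ _ [-> ->].
    by rewrite mulr_suml; apply: eq_bigr => x _; rewrite mulr_sumr.
  move: h1 fA gB (ler_norm_sum _ _ _ : `|\sum_(y <- B) g y| <= _).
  move: (hN B); set u := \sum_(x <- A) f x; set v := \sum_(y <- B) g y.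
  set r := \sum_(x <- _) _ * _; set n := \sum_(y <- B) `|_|.
  move=> nN hr hu hv vn.
  have -> : u * v + r - s * t = r + ((u - s) * v + s * (v - t)) by ring.
  rewrite (le_trans (ler_normD _ _)) // (le_trans (lerD hr (ler_normD _ _))) //.
  have h2 : `|(u - s) * v| <= e / 2 / 2 / N * N.
    by rewrite normrM ler_pM // (le_trans vn).
  have h3 : `|s * (v - t)| <= `|s| * (e / 2 / 2 / (M + `|s|)).
    by rewrite normrM ler_wpM2l.
  rewrite (le_trans (lerD (lexx _) (lerD h2 h3))) //.
  have Ms : M + `|s| != 0 by rewrite gt_eqF // ltr_wpDr.
  rewrite [leLHS](_ : _ = e / 2 / 2 + e / 2 / 2 + e / 2 / 2) //.
    by rewrite [in leRHS](splitr e) -splitr lerD2l ler_pdivrMr //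
      ler_peMr ?ler1n // ltW // divr_gt0.
  by field; rewrite Ms gt_eqF.
Qed.

End UnconditionalSums.

(** * Dominated convergence, and sums obtained from ordinary series *)

Section Tannery.
Local Open Scope classical_set_scope.
Variable K : numFieldType.

Lemma cvg_norm_le (u : nat -> K) (l e : K) :
  u n @[n --> \oo] --> l -> (forall n, `|u n| <= e) -> `|l| <= e.
Proof.
move=> hu hle; apply/ler_addgt0Pr => d d0.
move/cvgrPdist_le : hu => /(_ d d0) [N _ hN].
have := hN N (leqnn N); rewrite -lerBlDl => /= h.
rewrite -[X in `|X|](subrK (u N)) lerBlDl.
by rewrite (le_trans (ler_normD _ _)) // addrC lerD.
Qed.

Lemma cvg_fsum (T : choiceType) (F : nat -> T -> K) (f : T -> K) (A : {fset T}) :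
  (forall x, F N x @[N --> \oo] --> f x) ->
  \sum_(x <- A) F N x @[N --> \oo] --> \sum_(x <- A) f x.
Proof. by move=> h; apply: cvg_big => // ; exact: add_continuous. Qed.

(** The finite set that controls the tail of [g] controls those of all [F N] simultaneously; the
    resulting estimate is uniform in N and passes to the limit over each fixed finite set. *)
Lemma tannery (T : choiceType) (g : T -> K) (F : nat -> T -> K) (f : T -> K)
    (s : nat -> K) (t : K) :
  tight g -> (forall N x, `|F N x| <= `|g x|) ->
  (forall x, F N x @[N --> \oo] --> f x) ->
  (forall N, has_sum (F N) (s N)) -> s N @[N --> \oo] --> t -> has_sum f t.
Proof.
move=> tg hle hF hs ht.
have fle x : `|f x| <= `|g x| by exact: cvg_norm_le (hF x) (fun N => hle N x).
split.
  by apply: (tight_le (c := 1)) tg => // x; rewrite mul1r.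
move=> e e0; have [A hA] := tg e e0; exists A => B AB.
apply: (@cvg_norm_le (fun N => \sum_(x <- B) F N x - s N)).
  by apply: cvgB => //; exact: cvg_fsum.
move=> N; apply: has_sum_tail (hs N) _ AB => C hC.
exact: le_trans (ler_sum _ (fun x _ => hle N x)) (hA C hC).
Qed.

Lemma mem_fset_iota (n i : nat) : (i \in [fset j in iota 0 n]%fset) = (i < n)%N.
Proof. by rewrite in_fset /= mem_iota. Qed.

Lemma fsum_iota (f : nat -> K) (n : nat) :
  \sum_(x <- [fset i in iota 0 n]%fset) f x = \sum_(0 <= i < n) f i.
Proof.
rewrite /index_iota subn0; apply: perm_big; apply: uniq_perm => //.
  exact: iota_uniq.
by move=> i; rewrite inE.
Qed.

Lemma has_sum_series (f : nat -> K) (s : K) :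
  tight f -> series f n @[n --> \oo] --> s -> has_sum f s.
Proof.
move=> tf hs; split => // e e0; have [A hA] := tf e e0.
(* The index is shifted beyond every element of [B], so that each initial segment considered
   contains [B]. *)
exists A => B AB; apply: (@cvg_norm_le
   (fun n => \sum_(x <- B) f x - series f (n + \max_(i <- B) i.+1)%N)).
  apply: cvgB; first exact: cvg_cst.
  by rewrite (cvg_shiftn _ (series f)).
move=> n /=; set m := (n + _)%N; pose I := [fset i in iota 0 m]%fset.
have BI : (B `<=` I)%fset.
  apply/fsubsetP => i iB; rewrite mem_fset_iota.
  by apply: leq_trans (leq_addl _ _); rewrite (big_rem i) //= leq_maxl.
rewrite /series /= -fsum_iota (fsumD _ BI) opprD addrA subrr add0r normrN.
apply: (le_trans (ler_norm_sum _ _ _)); apply: hA => i; rewrite inE => /andP[+ _].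
by apply: contra; exact: (fsubsetP AB).
Qed.

Lemma has_sum_int (f : int -> K) s t :
  has_sum (fun k : nat => f k%:Z) s -> has_sum (fun k : nat => f (- k.+1%:Z)) t ->
  has_sum f (s + t).
Proof.
move=> hs ht.
pose h (z : int) : nat + nat := match z with Posz n => inl n | Negz n => inr n end.
pose h' (z : nat + nat) : int := match z with inl n => Posz n | inr n => Negz n end.
have hK : cancel h h' by case.
have hK' : cancel h' h by case.
have := has_sum_sum (f := f \o h') hs ht.
move=> /(has_sum_reindex hK hK'); apply: eq_has_sum => z /=.
by rewrite hK.
Qed.

End Tannery.

(** * Absolutely convergent complex series and bilateral sums *)

Section ComplexSeries.
Local Open Scope classical_set_scope.
Local Open Scope complex_scope.
Variable R : realType.
Local Notation C := (CC R).

Definition toC (x : R) : C := x%:C.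

Lemma toC_le (x y : R) : (toC x <= toC y) = (x <= y).
Proof. exact: lecR. Qed.

Lemma toC_lt (x y : R) : (toC x < toC y) = (x < y).
Proof. exact: ltcR. Qed.

Lemma ge0_toC (x : C) : 0 <= x -> x = toC (complex.Re x).
Proof. by move=> x0; rewrite /toC RRe_real // ger0_real. Qed.

Lemma normc_le_sum (z : C) :
  `|z| <= toC (`|complex.Re z| + `|complex.Im z|).
Proof.
case: z => a b; rewrite normc_def /= lecR.
rewrite -[leRHS]ger0_norm ?addr_ge0 // -sqrtr_sqr ler_wsqrtr //.
rewrite -[a ^+ 2]real_normK ?num_real // -[b ^+ 2]real_normK ?num_real //.
by rewrite sqrrD lerD2r lerDl mulrn_wge0 // mulr_ge0.
Qed.

Lemma cvg_ReIm (u : nat -> C) (a b : R) :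
  complex.Re (u n) @[n --> \oo] --> a -> complex.Im (u n) @[n --> \oo] --> b ->
  u n @[n --> \oo] --> (a +i* b : C).
Proof.
move=> /cvgrPdist_le ha /cvgrPdist_le hb; apply/cvgrPdist_le => e e0.
have e0' : 0 < complex.Re e / 2.
  by rewrite divr_gt0 // -toC_lt -ge0_toC // ltW.
have [N1 _ h1] := ha _ e0'; have [N2 _ h2] := hb _ e0'.
exists (maxn N1 N2) => // n /=; rewrite geq_max => /andP[n1 n2].
apply: le_trans (normc_le_sum _) _.
rewrite (ge0_toC (ltW e0)) toC_le [leRHS]splitr.
move: (h1 _ n1) (h2 _ n2); case: (u n) => x y /= *; exact: lerD.
Qed.

Lemma Im_normc (z : C) : `|complex.Im z|%:C <= `|z|.
Proof.
case: z => a b; rewrite normc_def /= lecR -sqrtr_sqr ler_wsqrtr //.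
by rewrite lerDr sqr_ge0.
Qed.

(** Completeness is drawn from the reals: the real and imaginary parts have bounded, nondecreasing
    sums of absolute values. *)
Lemma cvg_series_bounded (f : nat -> C) (M : C) :
  (forall n, \sum_(0 <= i < n) `|f i| <= M) -> cvgn (series f).
Proof.
move=> hM.
have M0 : 0 <= M by apply: le_trans (hM 0%N); rewrite big_geq.
have bnd (g : nat -> R) : (forall i, toC `|g i| <= `|f i|) -> cvgn (series g).
  move=> hg; apply: normed_cvg; apply: nondecreasing_is_cvgn.
    by apply: nondecreasing_series => i _ _; exact: normr_ge0.
  exists (complex.Re M) => _ [n _ <-].
  rewrite -toC_le -ge0_toC //; apply: le_trans (hM n).
  rewrite /series /= /toC rmorph_sum /=; exact: ler_sum.
have sRe n : complex.Re (series f n) = series (fun i => complex.Re (f i)) n.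
  rewrite /series /=; elim: n => [|n IH]; first by rewrite !big_geq.
  by rewrite !big_nat_recr //= -IH; case: (\sum_(_ <= _ < _) _) (f n) => ? ? [].
have sIm n : complex.Im (series f n) = series (fun i => complex.Im (f i)) n.
  rewrite /series /=; elim: n => [|n IH]; first by rewrite !big_geq.
  by rewrite !big_nat_recr //= -IH; case: (\sum_(_ <= _ < _) _) (f n) => ? ? [].
have /cvg_ex[/= a ha] := bnd _ (fun i => normc_ge_Re (f i)).
have /cvg_ex[/= b hb] := bnd _ (fun i => Im_normc (f i)).
apply: (cvgP (a +i* b : C)); apply: cvg_ReIm.
  by under eq_fun do rewrite sRe.
by under eq_fun do rewrite sIm.
Qed.

Lemma tight_series (f : nat -> C) : tight f ->
  cvgn (series f) /\ has_sum f (limn (series f)).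
Proof.
move=> tf; have [M _ hM] := tight_bounded tf.
have cf : cvgn (series f).
  by apply: (@cvg_series_bounded _ M) => n; rewrite -fsum_iota.
by split => //; apply: has_sum_series.
Qed.

Lemma tight_bisum (f : int -> C) : tight f ->
  bisummable f /\ has_sum f (bisum f).
Proof.
move=> tf.
have [c1 s1] := tight_series (tight_inj (h := Posz) (fun _ _ h => let: erefl := h in erefl) tf).
have [c2 s2] := tight_series (tight_inj (h := Negz) (fun _ _ h => let: erefl := h in erefl) tf).
split; [split; [exact: c1|exact: c2] | exact: has_sum_int s1 s2].
Qed.

Lemma archiC (e : C) : 0 < e -> exists n, 2 ^- n <= e.
Proof.
move=> e0; have e0' : 0 < complex.Re e by rewrite -toC_lt -ge0_toC // ltW.
have [n hn] : exists n, (complex.Re e)^-1 <= n%:R :> R.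
  exists (Num.bound (complex.Re e)^-1); apply: ltW; apply: archi_boundP.
  by rewrite invr_ge0 ltW.
exists n; rewrite (ge0_toC (ltW e0)).
have -> : (2 ^- n : C) = toC (2 ^- n).
  by rewrite /toC fmorphV rmorphXn /= rmorph_nat.
rewrite toC_le -[leRHS]invrK lef_pV2 ?posrE ?exprn_gt0 ?invr_gt0 //.
apply: le_trans hn _; rewrite -natrX ler_nat ltnW //; exact: ltn_expl.
Qed.

Lemma tight_exp2 : tight (fun n : nat => 2 ^- n : C).
Proof.
have tele N m : \sum_(N <= i < N + m) (2 ^- i : C) <= 2 * 2 ^- N - 2 * 2 ^- (N + m).
  elim: m => [|m IH]; first by rewrite addn0 big_geq // subrr.
  rewrite addnS big_nat_recr ?leq_addr //=; apply: le_trans (lerD IH (lexx _)) _.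
  rewrite exprS invfM le_eqVlt; apply/orP; left; apply/eqP.
  by move: (2 ^- (N + m)) (2 ^- N) => x y; field.
(* The tail from n + 1 on is at most 2 * 2^-(n+1) = 2^-n, hence the threshold [n.+1]. *)
move=> e e0; have [n hn] := archiC e0; exists [fset i in iota 0 n.+1]%fset => B hB.
pose m := \max_(i <- B) i.+1.
pose I := [fset i in iota 0 (n.+1 + m)]%fset.
have nI : ([fset i in iota 0 n.+1] `<=` I)%fset.
  by apply/fsubsetP => i; rewrite !mem_fset_iota => /leq_trans; apply; exact: leq_addr.
apply: (@le_trans _ _ (\sum_(x <- (I `\` [fset i in iota 0 n.+1])%fset) `|2 ^- x|)).
  apply: ler_fsum => //; apply/fsubsetP => i iB; rewrite inE hB //= mem_fset_iota.
  by apply: leq_trans (leq_addl _ _); rewrite /m (big_rem i) //= leq_maxl.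
have := fsumD (fun i => `|2 ^- i| : C) nI; rewrite !fsum_iota.
rewrite (@big_cat_nat _ _ _ n.+1) ?leq_addr //= => /addrI <-.
under eq_bigr do rewrite ger0_norm ?invr_ge0 ?exprn_ge0 //.
apply: le_trans (tele n.+1 m) _; apply: le_trans hn.
by rewrite exprS invfM mulrA divff // mul1r gerBl mulr_ge0 ?invr_ge0 ?exprn_ge0.
Qed.

Lemma tight_int_exp2 (f : int -> C) (c : C) : 0 < c ->
  (forall n : nat, `|f n%:Z| <= c * 2 ^- n) ->
  (forall n : nat, `|f (- n%:Z)| <= c * 2 ^- n) -> tight f.
Proof.
move=> c0 h1 h2.
pose h (z : int) : nat + nat := match z with Posz n => inl n | Negz n => inr n end.
pose h' (z : nat + nat) : int := match z with inl n => Posz n | inr n => Negz n end.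
have -> : f = (f \o h') \o h by apply/funext => -[].
apply: tight_inj; first by apply: can_inj (h') _; case.
have n2 n : `|2 ^- n : C| = 2 ^- n by rewrite ger0_norm ?invr_ge0 ?exprn_ge0.
apply: tight_sum; apply: (tight_le c0 _ tight_exp2) => n /=; rewrite n2.
  exact: h1.
rewrite NegzE; apply: le_trans (h2 _) _; rewrite ler_pM2l //.
by rewrite lef_pV2 ?posrE ?exprn_gt0 // ler_eXn2l ?ltr1n.
Qed.

(** From 1 + x <= exp x and the geometric series, exp(y / (1 - r)) is a bound; nonnegative elements
    of [C] are real, so the estimate is carried out in [R]. *)
Lemma prod_bounded (y r : C) : 0 <= y -> 0 <= r -> r < 1 ->
  exists2 K : C, 0 < K & forall n, \prod_(0 <= j < n) (1 + y * r ^+ j) <= K.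
Proof.
move=> y0 r0 r1; rewrite (ge0_toC y0) (ge0_toC r0).
set a := complex.Re y; set b := complex.Re r.
have a0 : 0 <= a by rewrite -toC_le -ge0_toC.
have b0 : 0 <= b by rewrite -toC_le -ge0_toC.
have b1 : b < 1 by rewrite -toC_lt -ge0_toC.
exists (toC (expR (a / (1 - b)))); first by rewrite toC_lt expR_gt0.
move=> n.
have -> : \prod_(0 <= j < n) (1 + toC a * toC b ^+ j) =
          toC (\prod_(0 <= j < n) (1 + a * b ^+ j)).
  rewrite /toC rmorph_prod; apply: eq_bigr => j _.
  by rewrite rmorphD rmorph1 rmorphM rmorphXn.
rewrite toC_le; apply: le_trans (_ : expR (a * \sum_(0 <= j < n) b ^+ j) <= _).
  rewrite mulr_sumr expR_sum; apply: ler_prod => j _.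
  by rewrite addr_ge0 ?mulr_ge0 ?exprn_ge0 //= expR_ge1Dx.
rewrite ler_expR ler_wpM2l // -[leRHS]mul1r ler_pdivlMr ?subr_gt0 // mulrC.
have -> : (1 - b) * (\sum_(0 <= j < n) b ^+ j) = 1 - b ^+ n.
  by rewrite big_mkord -opprB mulNr -subrX1 opprB.
by rewrite gerBl exprn_ge0.
Qed.

End ComplexSeries.

(** * Integer binomials, convergence and nonvanishing of q-products *)

Lemma binz2E (n : int) : (2 * binz2 n = n * (n - 1))%R.
Proof.
rewrite /binz2 mulrC divzK //.
have [h [->|->]] : exists h : int, n = 2 * h \/ n = 2 * h + 1.
- by exists (n %/ 2)%Z; lia.
- by rewrite -mulrA dvdz_mulr.
- by rewrite addrK mulrCA dvdz_mulr.
Qed.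

Lemma binz2_nat (n : nat) : binz2 n%:Z = 'C(n, 2)%:Z.
Proof.
have := binz2E n%:Z; have := mul_bin_diag n 1; case: n => [|n] //=.
by rewrite bin1; lia.
Qed.

Section QProducts.
Local Open Scope classical_set_scope.
Variable R : realType.
Local Notation C := (CC R).

Lemma norm_prod_le (a p : C) (n : nat) :
  `|\prod_(0 <= j < n) (1 - a * p ^+ j)| <=
  \prod_(0 <= j < n) (1 + `|a| * `|p| ^+ j).
Proof.
rewrite normr_prod; apply: ler_prod => j _; rewrite normr_ge0 /=.
apply: le_trans (ler_normD _ _) _.
by rewrite normrN normr1 normrM normrX.
Qed.

Lemma qprod_bounded (a p : C) : `|p| < 1 ->
  exists2 K : C, 0 < K & forall n, `|\prod_(0 <= j < n) (1 - a * p ^+ j)| <= K.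
Proof.
move=> p1; have [K K0 hK] := prod_bounded (normr_ge0 a) (normr_ge0 p) p1.
exists K => // n; exact: le_trans (norm_prod_le a p n) (hK n).
Qed.

Lemma cvg_qpoch (a p : C) : `|p| < 1 ->
  \prod_(0 <= j < n) (1 - a * p ^+ j) @[n --> \oo] --> qpoch a p.
Proof.
move=> p1; have [K K0 hK] := qprod_bounded a p1.
pose P n := \prod_(0 <= j < n) (1 - a * p ^+ j).
(* Since P (j + 1) - P j = - u j, the product is rewritten as a telescoping series; boundedness of
   [P] makes that series geometrically dominated. *)
pose u j := P j * (a * p ^+ j).
have PE : P = fun n => 1 - series u n.
  apply/funext; elim=> [|n IH]; first by rewrite /P /series /= !big_geq ?subr0.
  rewrite /P /series /= !big_nat_recr //= opprD addrA.
  by move: IH; rewrite /P /series /u /= => <-; rewrite mulrBr mulr1.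
have cu : cvgn (series u).
  apply: (@cvg_series_bounded _ _ (K * `|a| / (1 - `|p|))) => n.
  apply: (@le_trans _ _ (\sum_(0 <= i < n) K * `|a| * `|p| ^+ i)).
    apply: ler_sum => i _; rewrite normrM normrM normrX mulrA.
    by rewrite ler_wpM2r ?exprn_ge0 // ler_wpM2r //; exact: hK.
  rewrite -mulr_sumr ler_wpM2l ?mulr_ge0 ?(ltW K0) //.
  rewrite -[leRHS]mul1r ler_pdivlMr ?subr_gt0 // mulrC.
  have -> : (1 - `|p|) * (\sum_(0 <= j < n) `|p| ^+ j) = 1 - `|p| ^+ n.
    by rewrite big_mkord -opprB mulNr -subrX1 opprB.
  by rewrite gerBl exprn_ge0.
have cP : P n @[n --> \oo] --> 1 - limn (series u).
  by rewrite PE; apply: cvgB; [exact: cvg_cst | exact: cu].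
have cvP : cvgn P by exact: cvgP cP.
exact: cvP.
Qed.

Lemma qfac_neq0 (p : C) (n : nat) : `|p| < 1 ->
  \prod_(0 <= j < n) (1 - p * p ^+ j) != 0.
Proof.
move=> p1; rewrite prodf_seq_neq0; apply/allP => j _; apply/implyP => _.
rewrite subr_eq0 -exprS; apply/eqP => /(congr1 Num.norm); rewrite normr1 normrX.
by move/eqP; rewrite gt_eqF // exprn_ilt1.
Qed.

Lemma qfacV_bounded (p : C) : `|p| < 1 ->
  exists2 K : C, 0 < K &
    forall n, `|(\prod_(0 <= j < n) (1 - p * p ^+ j))^-1| <= K.
Proof.
move=> p1; have p10 : 0 < 1 - `|p| by rewrite subr_gt0.
(* With t = |p|^(j+1) <= |p|, one has 1 / (1 - t) = 1 + t / (1 - t) <= 1 + y |p|^j for y = |p| / (1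
   - |p|), so [prod_bounded] applies to the inverses as well. *)
have y0 : 0 <= `|p| / (1 - `|p|) by rewrite divr_ge0 // ltW.
have [K K0 hK] := prod_bounded y0 (normr_ge0 p) p1.
exists K => // n; apply: le_trans (hK n).
rewrite normrV ?unitfE ?qfac_neq0 // normr_prod -prodfV.
apply: ler_prod => j _; rewrite invr_ge0 normr_ge0 /=.
have pj : `|p| * `|p| ^+ j <= `|p| by rewrite ler_piMr // exprn_ile1 // ltW.
have h : 1 - `|p| * `|p| ^+ j <= `|1 - p * p ^+ j|.
  by apply: le_trans (lerB_dist _ _); rewrite normr1 normrM normrX.
have h0 : 0 < 1 - `|p| * `|p| ^+ j.
  by rewrite subr_gt0; apply: le_lt_trans pj p1.
apply: (@le_trans _ _ (1 - `|p| * `|p| ^+ j)^-1).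
  by rewrite lef_pV2 // posrE ?(lt_le_trans h0 h).
rewrite -[leLHS]mul1r ler_pdivrMr // mulrDl mul1r -{1}[1](subrK (`|p| * `|p| ^+ j)).
rewrite lerD2l.
rewrite -[leLHS]mulr1 [leRHS](_ : _ = `|p| * `|p| ^+ j * ((1 - `|p| * `|p| ^+ j) / (1 - `|p|))).
  by rewrite ler_wpM2l ?mulr_ge0 ?exprn_ge0 // ler_pdivlMr // mul1r lerD2l lerN2.
by field; rewrite gt_eqF.
Qed.

(** A zero limit would make the inverses of the partial products unbounded. *)
Lemma qpoch_neq0 (p : C) : `|p| < 1 -> qpoch p p != 0.
Proof.
move=> p1; have [K K0 hK] := qfacV_bounded p1.
have hc := cvg_qpoch (a := p) p1; apply/eqP => h0; rewrite h0 in hc.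
move/cvgrPdist_lt : hc => /(_ K^-1); rewrite invr_gt0 => /(_ K0)[n _ hn].
have := hn n (leqnn n); rewrite /= sub0r normrN => h; have := hK n.
rewrite normrV ?unitfE ?qfac_neq0 // => hle.
suff /lt_le_trans/(_ hle) : K < `|\prod_(0 <= j < n) (1 - p * p ^+ j)|^-1.
  by rewrite ltxx.
by rewrite -[ltLHS]invrK ltf_pV2 ?posrE ?invr_gt0 // normr_gt0 qfac_neq0.
Qed.

End QProducts.

(** * Decay of theta series and the q-binomial coefficients *)

Section Theta.
Local Open Scope classical_set_scope.
Variable R : realType.
Local Notation C := (CC R).

(** (4 x)^n r^C(n, 2) is the product of the 4 x r^j for j < n, hence bounded. Of 4 = 2 * 2, one
    factor 2^n absorbs n + 1 and the other yields the decay. *)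
Lemma gauss_decay (x r : C) : 0 <= x -> 0 <= r -> r < 1 ->
  exists2 K : C, 0 < K &
    forall n, n.+1%:R * (x ^+ n * r ^+ 'C(n, 2)) <= K * 2 ^- n.
Proof.
move=> x0 r0 r1.
have [K K0 hK] := prod_bounded (mulr_ge0 (ler0n _ 4) x0) r0 r1.
exists K => // n.
have prodE : (4 * x) ^+ n * r ^+ 'C(n, 2) = \prod_(0 <= j < n) (4 * x * r ^+ j).
  elim: n => [|n IH]; first by rewrite big_geq // !expr0 mulr1.
  by rewrite big_nat_recr //= -IH binS bin1 exprD exprSr; ring.
have h : 4 ^+ n * (x ^+ n * r ^+ 'C(n, 2)) <= K.
  rewrite mulrA -exprMn prodE; apply: le_trans (hK n).
  apply: ler_prod => j _.
  rewrite lerDr ler01 andbT !mulr_ge0 ?exprn_ge0 //.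
have h2 : n.+1%:R <= 2 ^+ n :> C by rewrite -natrX ler_nat ltn_expl.
have t0 : 0 < 2 ^+ n :> C by rewrite exprn_gt0.
rewrite ler_pdivlMr //; apply: le_trans h.
rewrite mulrAC (_ : 4 = 2 * 2) ?exprMn; last by rewrite -natrM.
by rewrite ler_wpM2r ?mulr_ge0 ?exprn_ge0 // ler_wpM2r // ltW.
Qed.

(** The growth allowed for [a] covers the weights 1 and k together. The negative half is a series of
    the same shape with p / z in place of z. *)
Lemma tight_theta (p z : C) (a : int -> C) : 0 < `|p| -> `|p| < 1 -> z != 0 ->
  (forall k : int, `|a k| <= (absz k).+1%:R) ->
  tight (fun k : int => a k * (z ^ k * p ^ binz2 k)).
Proof.
move=> p0 p1 z0 ha.
have pN0 : p != 0 by rewrite -normr_gt0.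
have zi0 : 0 <= `|p| / `|z| by rewrite divr_ge0.
have [K K0 hK] := gauss_decay (normr_ge0 z) (normr_ge0 p) p1.
have [L L0 hL] := gauss_decay zi0 (normr_ge0 p) p1.
apply: (@tight_int_exp2 _ _ (K + L)); first exact: addr_gt0.
- move=> n; rewrite normrM; apply: (@le_trans _ _ (n.+1%:R * (`|z| ^+ n * `|p| ^+ 'C(n, 2)))).
    by rewrite binz2_nat -!exprnP normrM !normrX ler_wpM2r ?mulr_ge0 ?exprn_ge0.
  apply: le_trans (hK n) _; rewrite ler_wpM2r ?invr_ge0 ?exprn_ge0 //.
  by rewrite lerDl ltW.
- move=> n; rewrite normrM.
  apply: (@le_trans _ _ (n.+1%:R * ((`|p| / `|z|) ^+ n * `|p| ^+ 'C(n, 2)))).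
    have -> : binz2 (- n%:Z) = ('C(n, 2) + n)%N%:Z.
      by have := binz2E (- n%:Z); have := binz2E n%:Z; rewrite binz2_nat; lia.
    have -> : `|z ^ (- n%:Z) * p ^ ('C(n, 2) + n)%N%:Z| =
              (`|p| / `|z|) ^+ n * `|p| ^+ 'C(n, 2).
      rewrite -exprnN -!exprnP normrM normrV ?unitfE ?expf_neq0 // !normrX.
      by rewrite exprD exprMn exprVn; ring.
    rewrite ler_wpM2r ?mulr_ge0 ?exprn_ge0 //.
    by apply: le_trans (ha _) _; rewrite abszN.
  apply: le_trans (hL n) _; rewrite ler_wpM2r ?invr_ge0 ?exprn_ge0 //.
  by rewrite lerDr ltW.
Qed.

Variable p : C.
Hypotheses (p0 : 0 < `|p|) (p1 : `|p| < 1).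

Let pN0 : p != 0. Proof. by rewrite -normr_gt0. Qed.

Definition qfac (n : nat) : C := \prod_(0 <= j < n) (1 - p * p ^+ j).

(** The convention 1 / (p; p)_m = 0 for m < 0 truncates the q-binomials and keeps [qfacV_rec] valid
    on all of Z: at m = -1 the factor 1 - p^0 vanishes. *)
Definition qfacV (m : int) : C := if m is Posz n then (qfac n)^-1 else 0.

Lemma qfacS n : qfac n.+1 = qfac n * (1 - p ^+ n.+1).
Proof. by rewrite /qfac big_nat_recr //= exprS. Qed.

Lemma qfacV_rec (m : int) : qfacV m = (1 - p ^ (m + 1)) * qfacV (m + 1).
Proof.
case: m => [n|[|n]].
- rewrite -PoszD addn1 /= -exprnP qfacS invfM mulrCA divff ?mulr1 //.
  by have := qfac_neq0 n.+1 p1; rewrite -/(qfac _) qfacS mulf_eq0 negb_or => /andP[].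
- by rewrite /= subrr mul0r.
- by rewrite NegzE (_ : - n.+2%:Z + 1 = Negz n) ?mulr0 // NegzE; lia.
Qed.

Lemma qfacV_norm : exists2 K : C, 0 < K & forall m, `|qfacV m| <= K.
Proof.
have [K K0 hK] := qfacV_bounded p1; exists K => // -[n|n] /=; first exact: hK.
by rewrite normr0 ltW.
Qed.

(* The coefficient of z^k p^(k(k-1)/2) in \prod_(j < N) (1 + z p^j) (1 + p^(j+1) / z). *)
Definition jtp_coef (N : nat) (k : int) : C :=
  qfac (N + N) * (qfacV (N%:Z - k) * qfacV (N%:Z + k)).

(** Passing from N to N + 1 multiplies the finite product by (1 + z p^N) (1 + p^(N+1) / z) = 1 +
    p^(2N+1) + z p^N + p^(N+1) / z; the three terms are the contributions to the coefficient of z^k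
    p^(k(k-1)/2). *)
Lemma jtp_coefS (N : nat) (k : int) :
  jtp_coef N.+1 k = (1 + p ^+ (N + N).+1) * jtp_coef N k
    + p ^ (N%:Z - k + 1) * jtp_coef N (k - 1)
    + p ^ (N%:Z + k + 1) * jtp_coef N (k + 1).
Proof.
rewrite /jtp_coef addSn addnS !qfacS.
set a := N%:Z - k; set b := N%:Z + k.
have -> : N.+1%:Z - k = a + 1 by rewrite /a; lia.
have -> : N.+1%:Z + k = b + 1 by rewrite /b; lia.
have -> : N%:Z - (k - 1) = a + 1 by rewrite /a; lia.
have -> : N%:Z + (k - 1) = b - 1 by rewrite /b; lia.
have -> : N%:Z - (k + 1) = a - 1 by rewrite /a; lia.
have -> : N%:Z + (k + 1) = b + 1 by rewrite /b; lia.
(* All inverse factorials are reduced to those at a + 1 and b + 1, and a + b = 2 N expresses p^(2N)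
   through p^a and p^b: a polynomial identity remains. *)
have ha := qfacV_rec a; have hb := qfacV_rec b.
have := qfacV_rec (a - 1); have := qfacV_rec (b - 1); rewrite !subrK ha hb => -> ->.
have -> : p ^+ (N + N).+2 = p * p * (p ^ a * p ^ b).
  by rewrite -expfzDr // (_ : a + b = (N + N)%N%:Z) ?/a ?/b -?exprnP ?exprS ?mulrA //; lia.
have -> : p ^+ (N + N).+1 = p * (p ^ a * p ^ b).
  by rewrite -expfzDr // (_ : a + b = (N + N)%N%:Z) ?/a ?/b -?exprnP ?exprS //; lia.
rewrite !expfzDr // !expr1z.
move: (p ^ a) (p ^ b) (qfac _) (qfacV _) (qfacV _) => x y Q u v.
ring.
Qed.

End Theta.

(** * Jacobi's triple product and his cube series *)

Section JacobiTripleProduct.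
Local Open Scope classical_set_scope.
Variable R : realType.
Local Notation C := (CC R).

Definition theta_term (p z : C) (k : int) : C := z ^ k * p ^ binz2 k.

Lemma theta_termS (p z : C) (k : int) : p != 0 -> z != 0 ->
  theta_term p z (k + 1) = z * p ^ k * theta_term p z k.
Proof.
move=> p0 z0; rewrite /theta_term (_ : binz2 (k + 1) = binz2 k + k).
  rewrite !expfzDr // expr1z.
  by move: (z ^ k) (p ^ k) (p ^ binz2 k) => x y t; ring.
by have := binz2E k; have := binz2E (k + 1); lia.
Qed.

Lemma theta_term_pred (p z : C) (k : int) : p != 0 -> z != 0 ->
  z * p ^ (k - 1) * theta_term p z (k - 1) = theta_term p z k.
Proof. by move=> p0 z0; rewrite -theta_termS // subrK. Qed.

Lemma has_sum_shift (f : int -> C) (d : int) s :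
  has_sum f s -> has_sum (fun k => f (k + d)) s.
Proof.
apply: (@has_sum_reindex _ _ _ (fun k => k + d) (fun k => k - d) f s).
- by move=> k; rewrite addrK.
- by move=> k; rewrite subrK.
Qed.

Variable p : C.
Hypotheses (p0 : 0 < `|p|) (p1 : `|p| < 1).

Let pN0 : p != 0. Proof. by rewrite -normr_gt0. Qed.

Lemma jtp_termS (z : C) (N : nat) (k : int) : z != 0 ->
  jtp_coef p N.+1 k * theta_term p z k =
  (1 + p ^+ (N + N).+1) * (jtp_coef p N k * theta_term p z k)
  + z * p ^+ N * (jtp_coef p N (k - 1) * theta_term p z (k - 1))
  + p ^+ N.+1 / z * (jtp_coef p N (k + 1) * theta_term p z (k + 1)).
Proof.
move=> z0; rewrite jtp_coefS // theta_termS // -(theta_term_pred k pN0 z0).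
rewrite !mulrDl; congr (_ + _ + _); first by rewrite -!mulrA.
- have -> : p ^ (N%:Z - k + 1) = p ^+ N * (p ^ (k - 1))^-1.
    by rewrite invr_expz exprnP -expfzDr //; congr (_ ^ _); lia.
  have : p ^ (k - 1) != 0 by exact: expfz_neq0.
  by move: (p ^ (k - 1)) => x x0; field.
- rewrite (_ : p ^ (N%:Z + k + 1) = p ^+ N.+1 * p ^ k).
    have : p ^ (k - 1) != 0 by exact: expfz_neq0.
    by move: (p ^ (k - 1)) => x x0; field.
  by rewrite exprnP -expfzDr //; congr (_ ^ _); lia.
Qed.

(** Only |k| <= N contributes, but summing over all of Z lets the induction shift k without boundary
    terms. *)
Lemma has_sum_jtp_finite (z : C) (N : nat) : z != 0 ->
  has_sum (fun k => jtp_coef p N k * theta_term p z k)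
    (\prod_(0 <= j < N) (1 + z * p ^+ j) * \prod_(0 <= j < N) (1 + p / z * p ^+ j)).
Proof.
move=> z0; elim: N => [|N IH].
  rewrite !big_geq // mulr1; apply: eq_has_sum (has_sum_delta 0 1) => k.
  rewrite /jtp_coef sub0r add0r; case: (intP k) => [|n|n].
  - by rewrite eqxx /= /qfac big_geq // invr1 !mul1r /theta_term expr0z
      mul1r /binz2 mul0r div0z expr0z.
  - by rewrite /= mul0r mulr0 mul0r.
  - by rewrite /= !mulr0 mul0r.
rewrite !big_nat_recr //=.
set A := \prod_(0 <= j < N) (1 + z * _) in IH *.
set B := \prod_(0 <= j < N) (1 + _ / z * _) in IH *.
have h := has_sumD (has_sumD (has_sumZ (1 + p ^+ (N + N).+1) IH)
   (has_sumZ (z * p ^+ N) (has_sum_shift (-1) IH)))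
   (has_sumZ (p ^+ N.+1 / z) (has_sum_shift 1 IH)).
have -> : A * (1 + z * p ^+ N) * (B * (1 + p / z * p ^+ N)) =
    (1 + p ^+ (N + N).+1) * (A * B) + z * p ^+ N * (A * B) + p ^+ N.+1 / z * (A * B).
  by rewrite !exprS exprD; field.
by apply: eq_has_sum h => k; rewrite (jtp_termS N k z0).
Qed.

(* Multiplying by k the recurrence of [jtp_termS] brings in S because the
   shifted terms carry the weights k - 1 and k + 1. *)
Lemma has_sum_jtp_weighted (z S T : C) (N : nat) : z != 0 ->
  has_sum (fun k => jtp_coef p N k * theta_term p z k) S ->
  has_sum (fun k => k%:~R * (jtp_coef p N k * theta_term p z k)) T ->
  has_sum (fun k => k%:~R * (jtp_coef p N.+1 k * theta_term p z k))
    ((1 + p ^+ (N + N).+1) * T + z * p ^+ N * (T + S) + p ^+ N.+1 / z * (T - S)).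
Proof.
move=> z0 hS hT.
have h1 := has_sumZ (1 + p ^+ (N + N).+1) hT.
have h2 := has_sumZ (z * p ^+ N)
  (has_sumD (has_sum_shift (-1) hT) (has_sum_shift (-1) hS)).
have h3 := has_sumZ (p ^+ N.+1 / z)
  (has_sumD (has_sum_shift 1 hT) (has_sumN (has_sum_shift 1 hS))).
apply: eq_has_sum (has_sumD (has_sumD h1 h2) h3) => k /=.
rewrite (jtp_termS N k z0) rmorphB rmorphD /=.
move: (jtp_coef _ _ _ * _) (jtp_coef _ _ _ * _) (jtp_coef _ _ _ * _) => u v w.
by ring.
Qed.

(** At z = -1 and N >= 1 the unweighted sum is 0, because its product contains 1 + z. The weighted
    sum is then multiplied by 1 + p^(2N+1) - p^N - p^(N+1) = (1 - p^N) (1 - p^(N+1)). The first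
    step, from N = 0, gives -(1 - p). *)
Lemma has_sum_jtp_weightedN1 (N : nat) :
  has_sum (fun k => k%:~R * (jtp_coef p N.+1 k * theta_term p (-1) k))
    (- (qfac p N.+1 * qfac p N)).
Proof.
have n10 : -1 != 0 :> C by rewrite oppr_eq0 oner_eq0.
elim: N => [|N IH].
- have T0 : has_sum (fun k => k%:~R * (jtp_coef p 0 k * theta_term p (-1) k)) 0.
    apply: eq_has_sum (@has_sum0 _ _) => k.
    rewrite /jtp_coef sub0r add0r; case: (intP k) => [|n|n].
    + by rewrite mul0r.
    + by rewrite /= mul0r mulr0 mul0r mulr0.
    + by rewrite /= !mulr0 mul0r mulr0.
  have := has_sum_jtp_weighted n10 (has_sum_jtp_finite 0 n10) T0.
  congr (has_sum _ _); rewrite /qfac big_nat1 !big_geq // invrN1.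
  by rewrite addn0 expr0 expr1; ring.
- have := has_sum_jtp_weighted n10 (has_sum_jtp_finite N.+1 n10) IH.
  congr (has_sum _ _); rewrite big_nat_recl // expr0 mulr1 subrr !mul0r subr0 addr0 invrN1.
  by rewrite (qfacS p N.+1) (qfacS p N) addSn addnS !exprS exprD; ring.
Qed.

Lemma cvg_qpochN (a : C) :
  \prod_(0 <= j < n) (1 + a * p ^+ j) @[n --> \oo] --> qpoch (- a) p.
Proof.
have := cvg_qpoch (a := - a) p1.
by under eq_fun do under eq_bigr do rewrite mulNr opprK.
Qed.

Lemma cvg_qfac : qfac p n @[n --> \oo] --> qpoch p p.
Proof. exact: cvg_qpoch. Qed.

Lemma cvg_qfacV (k : int) :
  qfacV p (n%:Z + k) @[n --> \oo] --> (qpoch p p)^-1.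
Proof.
have h : (qfac p n)^-1 @[n --> \oo] --> (qpoch p p)^-1.
  by apply: cvgV; [exact: qpoch_neq0 | exact: cvg_qfac].
case: k => m.
  rewrite (_ : (fun n => _) = (fun n => (qfac p (n + m))^-1)) //.
  by rewrite (cvg_shiftn m (fun n => (qfac p n)^-1)).
(* For negative k finitely many terms carry the default value 0; the shift discards them. *)
rewrite -(cvg_shiftn m.+1).
rewrite (_ : (fun n => _) = (fun n => (qfac p n)^-1)) //.
apply/funext => n; rewrite NegzE (_ : (n + m.+1)%N%:Z - m.+1%:Z = n%:Z) //; lia.
Qed.

Lemma jtp_coef_norm : exists2 M : C, 0 < M & forall N k, `|jtp_coef p N k| <= M.
Proof.
have [K K0 hK] := qprod_bounded p p1; have [L L0 hL] := qfacV_norm p1.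
exists (K * (L * L)) => [|N k]; first by rewrite !mulr_gt0.
by rewrite !normrM ler_pM ?mulr_ge0 ?ler_pM ?hK ?hL.
Qed.

Lemma cvg_jtp_coef (k : int) : jtp_coef p N k @[N --> \oo] --> (qpoch p p)^-1.
Proof.
have h : qfac p (N + N) @[N --> \oo] --> qpoch p p.
  apply: (@cvg_comp _ _ _ (fun N : nat => (N + N)%N) (qfac p) _ \oo); last exact: cvg_qfac.
  by move=> A [n _ hn]; exists n => // m /= nm; apply: hn => /=; apply: leq_trans nm (leq_addr _ _).
rewrite -(mulVKf (qpoch_neq0 p1) (qpoch p p)^-1).
exact: cvgM h (cvgM (cvg_qfacV (- k)) (cvg_qfacV k)).
Qed.

(** The coefficients are bounded uniformly in N and k and tend to 1 / (p; p)_oo, so the limit passes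
    under the sum; multiplying by (p; p)_oo finishes. *)
Theorem jacobi_triple_product (z : C) : z != 0 ->
  has_sum (theta_term p z) (qpoch (- z) p * qpoch (- (p / z)) p * qpoch p p).
Proof.
move=> z0; have G0 := qpoch_neq0 p1; have [M M0 hM] := jtp_coef_norm.
have tt : tight (fun k => M * theta_term p z k).
  apply: (@tight_le _ _ (fun k : int => 1 * (z ^ k * p ^ binz2 k)) _ M) => //.
    by move=> k; rewrite mul1r normrM gtr0_norm.
  by apply: (tight_theta (a := fun=> 1)) => // k; rewrite normr1 ler1n.
have cA : \prod_(0 <= j < N) (1 + z * p ^+ j) * \prod_(0 <= j < N) (1 + p / z * p ^+ j)
    @[N --> \oo] --> qpoch (- z) p * qpoch (- (p / z)) p.
  by apply: cvgM; exact: cvg_qpochN.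
have := tannery tt _ _ (fun N => has_sum_jtp_finite N z0) cA.
move=> /(_ (fun k => (qpoch p p)^-1 * theta_term p z k)) h.
have {}h : has_sum (fun k => (qpoch p p)^-1 * theta_term p z k)
    (qpoch (- z) p * qpoch (- (p / z)) p).
  apply: h => [N k|k].
    rewrite [X in X <= _]normrM [X in _ <= X]normrM.
    by rewrite ler_wpM2r // (le_trans (hM N k)) // gtr0_norm.
  by apply: cvgM; [exact: cvg_jtp_coef | exact: cvg_cst].
rewrite mulrC; apply: eq_has_sum (has_sumZ (qpoch p p) h) => k.
by rewrite mulrA divff // mul1r.
Qed.

(** Pairing k with 1 - k recovers the familiar series of (-1)^n (2 n + 1) p^(n(n+1)/2) over n >= 0.
    The finite values tend to -(p; p)_oo^2, and the third factor comes from the limit of the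
    coefficients. *)
Theorem jacobi_cube :
  has_sum (fun k => k%:~R * theta_term p (-1) k) (- qpoch p p ^+ 3).
Proof.
have n10 : -1 != 0 :> C by rewrite oppr_eq0 oner_eq0.
have G0 := qpoch_neq0 p1; have [M M0 hM] := jtp_coef_norm.
have tt : tight (fun k : int => M * (k%:~R * theta_term p (-1) k)).
  apply: (@tight_le _ _ (fun k : int => k%:~R * ((-1) ^ k * p ^ binz2 k)) _ M) => //.
    by move=> k; rewrite normrM gtr0_norm.
  apply: (tight_theta (a := fun k => k%:~R)) => // k.
  by rewrite normrMz normr1 -abszE ler_nat ltnW.
have cA : - (qfac p N.+1 * qfac p N) @[N --> \oo] --> - (qpoch p p * qpoch p p).
  apply: cvgN; apply: cvgM; last exact: cvg_qfac.
  by have := cvg_qfac; rewrite -(cvg_shiftS (qfac p)).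
have := tannery tt _ _ has_sum_jtp_weightedN1 cA.
move=> /(_ (fun k => (qpoch p p)^-1 * (k%:~R * theta_term p (-1) k))) h.
have {}h : has_sum (fun k => (qpoch p p)^-1 * (k%:~R * theta_term p (-1) k))
    (- (qpoch p p * qpoch p p)).
  apply: h => [N k|k].
    rewrite mulrCA [X in X <= _]normrM [X in _ <= X]normrM.
    by rewrite ler_wpM2r // (le_trans (hM N.+1 k)) // gtr0_norm.
  rewrite (_ : (fun N => _) = fun N => jtp_coef p N.+1 k * (k%:~R * theta_term p (-1) k)).
    apply: cvgM; last exact: cvg_cst.
    by have := cvg_jtp_coef k; rewrite -(cvg_shiftS (fun N => jtp_coef p N k)).
  by apply/funext => N; rewrite mulrCA.
rewrite (_ : - qpoch p p ^+ 3 = qpoch p p * (- (qpoch p p * qpoch p p))); last by ring.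
by apply: eq_has_sum (has_sumZ (qpoch p p) h) => k; rewrite mulrA divff // mul1r.
Qed.

End JacobiTripleProduct.

(** * The weighted double series and its splitting modulo 3 *)

Section SplitDoubleSum.
Local Open Scope classical_set_scope.
Variable R : realType.
Local Notation C := (CC R).

Lemma cvg_unique_seq (u : nat -> C) (a b : C) :
  u n @[n --> \oo] --> a -> u n @[n --> \oo] --> b -> a = b.
Proof. by move=> ha hb; apply: (cvg_unique _ ha hb). Qed.

(** The exponents 1, 2, 3, ... of t are sorted by residue modulo 3, which is exact on partial
    products of length 3 n. *)
Lemma qpoch_trisection (t : C) : `|t| < 1 ->
  qpoch t (t ^+ 3) * qpoch (t ^+ 2) (t ^+ 3) * qpoch (t ^+ 3) (t ^+ 3) = qpoch t t.
Proof.
move=> t1; have t31 : `|t ^+ 3| < 1 by rewrite normrX exprn_ilt1.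
apply: (@cvg_unique_seq (fun n => \prod_(0 <= j < 3 * n) (1 - t * t ^+ j))).
  pose P a n := \prod_(0 <= j < n) (1 - a * (t ^+ 3) ^+ j).
  rewrite (_ : (fun n => _) = fun n => P t n * P (t ^+ 2) n * P (t ^+ 3) n).
    by apply: cvgM; [apply: cvgM|]; exact: cvg_qpoch.
  apply/funext; elim=> [|n IH]; first by rewrite muln0 /P !big_geq // !mulr1.
  rewrite mulnS addSn addSn addSn add0n /P !big_nat_recr //= IH /P.
  rewrite -!exprM; move: (\prod_(_ <= _ < _) _) (\prod_(_ <= _ < _) _) (\prod_(_ <= _ < _) _).
  by move=> x y z; rewrite !exprS; ring.
apply: (@cvg_comp _ _ _ (fun n : nat => (3 * n)%N)
  (fun n => \prod_(0 <= j < n) (1 - t * t ^+ j)) _ \oo); last exact: cvg_qpoch.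
move=> A [n _ hn]; exists n => // m /= nm; apply: hn => /=.
by apply: leq_trans nm _; rewrite leq_pmull.
Qed.

Lemma qpoch1 (p : C) : `|p| < 1 -> qpoch 1 p = 0.
Proof.
move=> p1; have := cvg_qpoch (a := 1) p1 => h.
apply: (@cvg_unique_seq (fun n => \prod_(0 <= j < n.+1) (1 - 1 * p ^+ j))).
  by move: h; rewrite -(cvg_shiftS (fun n => \prod_(0 <= j < n) (1 - 1 * p ^+ j))).
under eq_fun do rewrite big_nat_recl // expr0 mulr1 subrr mul0r.
exact: cvg_cst.
Qed.

Lemma sign_even (v : int) : (-1 : C) ^ (2 * v) = 1.
Proof. by rewrite -exprz_exp -[(-1) ^ 2]/((-1) ^+ 2) sqrrN expr1n exp1rz. Qed.

Lemma theta_termE (q : C) (a b : nat) (k : int) : q != 0 ->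
  theta_term (q ^+ a) (q ^+ b) k = q ^ (b%:Z * k + a%:Z * binz2 k).
Proof. by move=> q0; rewrite /theta_term !exprnP !exprz_exp expfzDr. Qed.

Lemma theta_termNE (q : C) (a b : nat) (k : int) : q != 0 ->
  theta_term (q ^+ a) (- q ^+ b) k = (-1) ^ k * q ^ (b%:Z * k + a%:Z * binz2 k).
Proof.
move=> q0; rewrite -(theta_termE a b k q0) /theta_term -[- q ^+ b]mulN1r.
by rewrite expfzMl mulrA.
Qed.

(* Splits Z^2 according to m + n mod 3. On the classes 1 and 0 the double series
   becomes the product of the same two series in u and v; on the class 2 the
   series in u is odd under u -> -1 - u and vanishes. *)
Definition split3 (x : (int * int + int * int) + int * int) : int * int :=
  match x with
  | inl (inl (u, v)) => (2 * v + u + 1, v - u)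
  | inl (inr (u, v)) => (- 2 * v - u, u - v)
  | inr (u, v) => (2 * v + u + 2, v - u)
  end.

(** On the three classes m + n is 3 v + 1, - 3 v and 3 v + 2, so the quotient by 3 is v, - v and
    v. *)
Definition unsplit3 (x : int * int) : (int * int + int * int) + int * int :=
  let: (m, n) := x in
  let v := ((m + n) %/ 3)%Z in
  if ((m + n) %% 3)%Z == 1 then inl (inl (v - n, v))
  else if ((m + n) %% 3)%Z == 0 then inl (inr (n - v, - v))
  else inr (v - n, v).

Lemma split3K : cancel split3 unsplit3.
Proof.
case=> [[[u v]|[u v]]|[u v]] /=.
- have -> : ((2 * v + u + 1 + (v - u)) %% 3)%Z = 1 by lia.
  have -> : ((2 * v + u + 1 + (v - u)) %/ 3)%Z = v by lia.
  by rewrite eqxx subKr.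
- have -> : ((- 2 * v - u + (u - v)) %% 3)%Z = 0 by lia.
  have -> : ((- 2 * v - u + (u - v)) %/ 3)%Z = - v by lia.
  by rewrite /= opprK subrK.
- have -> : ((2 * v + u + 2 + (v - u)) %% 3)%Z = 2 by lia.
  have -> : ((2 * v + u + 2 + (v - u)) %/ 3)%Z = v by lia.
  by rewrite /= subKr.
Qed.

Lemma unsplit3K : cancel unsplit3 split3.
Proof.
case=> m n; rewrite /unsplit3; case: eqP => [h|h]; last case: eqP => [h'|h'];
  congr (_, _); lia.
Qed.

Variable q : C.
Hypotheses (q0 : 0 < `|q|) (q1 : `|q| < 1).

Let qN0 : q != 0. Proof. by rewrite -normr_gt0. Qed.
Let n10 : -1 != 0 :> C. Proof. by rewrite oppr_eq0 oner_eq0. Qed.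
Let qX0 n : 0 < `|q ^+ n|. Proof. by rewrite normr_gt0 expf_neq0. Qed.
Let qX1 n : `|q ^+ n.+1| < 1. Proof. by rewrite normrX exprn_ilt1. Qed.
Let qXN0 n : q ^+ n != 0. Proof. by rewrite expf_neq0. Qed.

(** The argument - q in base q^2 produces (-1)^n q^(n^2); it is written [- q ^+ 1] to fit
    [theta_termNE]. *)
Let F (x : int * int) : C :=
  (2 * x.1 - 1 - 4 * x.2)%:~R * (theta_term q (-1) x.1 * theta_term (q ^+ 2) (- q ^+ 1) x.2).

Let A u : C := (6 * u + 1)%:~R * theta_term (q ^+ 3) (q ^+ 2) u.
Let B v : C := theta_term (q ^+ 6) (- q ^+ 4) v.
Let A' u : C := (2 * u + 1)%:~R * theta_term (q ^+ 3) (q ^+ 3) u.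
Let B' v : C := theta_term (q ^+ 6) (- q ^+ 6) v.

Let FE (m n : int) : F (m, n) =
  (2 * m - 1 - 4 * n)%:~R * ((-1) ^ (m + n) * q ^ (binz2 m + (n + 2 * binz2 n))).
Proof.
rewrite /F theta_termNE //= {1}/theta_term mulrACA -expfzDr // -expfzDr //.
by rewrite mul1r.
Qed.

Let F1 (u v : int) : F (split3 (inl (inl (u, v)))) = - (A u * B v).
Proof.
rewrite /= FE /A /B theta_termNE // theta_termE //.
rewrite (_ : 2 * v + u + 1 + (v - u) = 2 * v + v + 1); last by lia.
rewrite !(expfzDr _ _ n10) sign_even expr1z.
rewrite (_ : 2 * (2 * v + u + 1) - 1 - 4 * (v - u) = 6 * u + 1); last by lia.
rewrite (_ : binz2 (2 * v + u + 1) + (v - u + 2 * binz2 (v - u)) =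
  (2%:Z * u + 3%:Z * binz2 u) + (4%:Z * v + 6%:Z * binz2 v)).
  by rewrite (expfzDr (2%:Z * u + 3%:Z * binz2 u)) //; ring.
(* Doubling the binomials removes the quotients and leaves a polynomial identity between
   exponents. *)
have := binz2E (2 * v + u + 1); have := binz2E (v - u).
by have := binz2E u; have := binz2E v; lia.
Qed.

(** This class is the image of the preceding one under (m, n) -> (1 - m, - n), which fixes the
    exponent and negates both the weight and the sign (-1)^(m + n). *)
Let F2 (u v : int) : F (split3 (inl (inr (u, v)))) = - (A u * B v).
Proof.
rewrite /= FE /A /B theta_termNE // theta_termE //.
rewrite (_ : - 2 * v - u + (u - v) = 2 * (- 2 * v) + v); last by lia.
rewrite !(expfzDr _ _ n10) sign_even.
rewrite (_ : 2 * (- 2 * v - u) - 1 - 4 * (u - v) = - (6 * u + 1)); last by lia.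
rewrite (_ : binz2 (- 2 * v - u) + (u - v + 2 * binz2 (u - v)) =
  (2%:Z * u + 3%:Z * binz2 u) + (4%:Z * v + 6%:Z * binz2 v)).
  by rewrite (expfzDr (2%:Z * u + 3%:Z * binz2 u)) // rmorphN; ring.
have := binz2E (- 2 * v - u); have := binz2E (u - v).
by have := binz2E u; have := binz2E v; lia.
Qed.

Let F3 (u v : int) : F (split3 (inr (u, v))) = 3 * q * (A' u * B' v).
Proof.
rewrite /= FE /A' /B' theta_termNE // theta_termE //.
rewrite (_ : 2 * v + u + 2 + (v - u) = 2 * (v + 1) + v); last by lia.
rewrite !(expfzDr _ _ n10) sign_even.
rewrite (_ : 2 * (2 * v + u + 2) - 1 - 4 * (v - u) = 3 * (2 * u + 1)); last by lia.
rewrite (_ : binz2 (2 * v + u + 2) + (v - u + 2 * binz2 (v - u)) =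
  (3%:Z * u + 3%:Z * binz2 u) + (6%:Z * v + 6%:Z * binz2 v) + 1).
  rewrite expfzDr // expr1z (expfzDr (3%:Z * u + 3%:Z * binz2 u)) // rmorphM /=.
  by ring.
have := binz2E (2 * v + u + 2); have := binz2E (v - u).
by have := binz2E u; have := binz2E v; lia.
Qed.

(** Only existence is asked: the values obtained are multiplied by 0, shown to be 0 by symmetry, or
    solved for at the end. *)
Let weighted (p z : C) (a b : int) : 0 < `|p| -> `|p| < 1 -> z != 0 ->
  exists s, has_sum (fun k => (a * k + b)%:~R * theta_term p z k) s.
Proof.
move=> p0 p1 z0; have [] := tight_bisum (tight_theta (a := fun k => k%:~R) p0 p1 z0 _).
  by move=> k; rewrite normrMz normr1 -abszE ler_nat ltnW.
set t := bisum _ => _ ht; have := jacobi_triple_product p0 p1 z0.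
set u := _ * qpoch p p => hu; exists (a%:~R * t + b%:~R * u).
apply: eq_has_sum (has_sumD (has_sumZ a%:~R ht) (has_sumZ b%:~R hu)) => k.
by rewrite rmorphD rmorphM /= mulrDl mulrA.
Qed.

Let sumA' : has_sum A' 0.
Proof.
have [s hs] := weighted 2 1 (qX0 3) (qX1 2) (qXN0 3).
have hs' : has_sum (fun u => - A' u) s.
  apply: eq_has_sum (has_sum_reindex (h := fun u => - u - 1) (g := fun u => - u - 1) _ _ hs).
  - move=> u /=; rewrite /A' !theta_termE // (_ : 2 * (- u - 1) + 1 = - (2 * u + 1)); last by lia.
    rewrite rmorphN mulNr; congr (- (_ * q ^ _)).
    by have := binz2E u; have := binz2E (- u - 1); lia.
  - by move=> u; lia.
  - by move=> u; lia.
have := has_sum_unique hs (eq_has_sum _ (has_sumN hs')).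
move=> /(_ (fun u => opprK _)) /eqP; rewrite -subr_eq0 opprK -mulr2n mulrn_eq0 /=.
by move/eqP => s0; rewrite s0 in hs.
Qed.

Lemma has_sum_6n1_theta : has_sum (fun u => (6 * u + 1)%:~R * theta_term (q ^+ 3) (q ^+ 2) u)
  (qpoch q q ^+ 3 * qpoch q (q ^+ 2) ^+ 2).
Proof.
have qN1 : - q ^+ 1 != 0 by rewrite oppr_eq0.
have hJ := jacobi_cube q0 q1.
have h0 : has_sum (theta_term q (-1)) 0.
  have := jacobi_triple_product q0 q1 n10.
  by rewrite opprK (qpoch1 q1) 2!mul0r => h; exact: h.
have hphi : has_sum (theta_term (q ^+ 2) (- q ^+ 1))
    (qpoch q (q ^+ 2) ^+ 2 * qpoch (q ^+ 2) (q ^+ 2)).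
  have := jacobi_triple_product (qX0 2) (qX1 1) qN1.
  rewrite opprK expr1 invrN mulrN opprK (_ : q ^+ 2 / q = q) -?expr2 //.
  by rewrite expr2 mulfK.
have [t ht] := weighted 4 1 (qX0 2) (qX1 1) qN1.
have tri : qpoch (q ^+ 2) (q ^+ 6) * qpoch (q ^+ 4) (q ^+ 6) * qpoch (q ^+ 6) (q ^+ 6)
    = qpoch (q ^+ 2) (q ^+ 2).
  by have := qpoch_trisection (qX1 1); rewrite -!exprM.
have hB : has_sum B (qpoch (q ^+ 2) (q ^+ 2)).
  have qN4 : - q ^+ 4 != 0 by rewrite oppr_eq0.
  rewrite -tri [X in has_sum _ (X * _)]mulrC.
  have := jacobi_triple_product (qX0 6) (qX1 5) qN4.
  rewrite opprK invrN mulrN opprK (_ : q ^+ 6 / q ^+ 4 = q ^+ 2); first exact.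
  by rewrite (exprD q 2 4) mulfK.
set G := qpoch q q in hJ *; set J := qpoch (q ^+ 2) (q ^+ 2) in hphi hB *.
set P := qpoch q (q ^+ 2) in hphi *.
have J0 : J != 0 by exact: qpoch_neq0.
(* The weight is cut as 2 m - (4 n + 1): the second product has the factor [h0], a zero sum over m,
   so the value [t] never matters. *)
have hF : has_sum F (2 * (- G ^+ 3 * (P ^+ 2 * J)) + - (0 * t)).
  apply: eq_has_sum (has_sumD (has_sumZ 2 (has_sum_prod hJ hphi))
    (has_sumN (has_sum_prod h0 ht))) => -[m n].
  rewrite /F /= (_ : 2 * m - 1 - 4 * n = 2 * m - (4 * n + 1)); last by lia.
  rewrite rmorphB rmorphM /=.
  by move: (theta_term _ _ _) (theta_term _ _ _) => x y; ring.
have [s hs] := weighted 6 1 (qX0 3) (qX1 2) (qXN0 2).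
have [b' hb'] : exists b', has_sum B' b'.
  have qN6 : - q ^+ 6 != 0 by rewrite oppr_eq0.
  have hb := jacobi_triple_product (qX0 6) (qX1 5) qN6.
  by eexists; exact hb.
have hAB := has_sumN (has_sum_prod hs hB).
have h1 : has_sum (F \o split3 \o inl \o inl) (- (s * J)).
  by apply: eq_has_sum hAB => -[u v]; rewrite [RHS]F1.
have h2 : has_sum (F \o split3 \o inl \o inr) (- (s * J)).
  by apply: eq_has_sum hAB => -[u v]; rewrite [RHS]F2.
have h3 : has_sum (F \o split3 \o inr) 0.
  have := has_sumZ (3 * q) (has_sum_prod sumA' hb').
  rewrite mul0r mulr0; apply: eq_has_sum => -[u v]; rewrite [RHS]F3; exact: erefl.
(* Two values of the same double sum are compared: -2 G^3 P^2 J and -2 s J, with [s] still unknown;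
   [J] is nonzero and cancels. *)
have e := has_sum_unique (has_sum_reindex split3K unsplit3K hF)
  (has_sum_sum (has_sum_sum h1 h2) h3).
suff -> : G ^+ 3 * P ^+ 2 = s by exact: hs.
have n20 : -2 != 0 :> C by rewrite oppr_eq0 pnatr_eq0.
apply: (mulIf J0); apply: (mulfI n20); transitivity (- (s * J) + - (s * J) + 0).
  by rewrite -e; ring.
by ring.
Qed.

End SplitDoubleSum.

(** * Evaluation of the bilateral series *)

Unset Implicit Arguments.
Theorem theorem2p16 (R : realType) (q : CC R) (hq0 : 0 < `|q|) (hq1 : `|q| < 1) :
  let f : int -> CC R := fun n => n%:~R * q ^ (3 * binz2 n + 2 * n) in
  bisummable f /\
  6 * bisum f =
    qpoch q q ^+ 3 * qpoch q (q ^+ 2) ^+ 2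
    - qpoch (- q) (q ^+ 3) * qpoch (- q ^+ 2) (q ^+ 3) * qpoch (q ^+ 3) (q ^+ 3).
Proof.
move=> f; have qN0 : q != 0 by rewrite -normr_gt0.
have p0 : 0 < `|q ^+ 3| by rewrite normr_gt0 expf_neq0.
have p1 : `|q ^+ 3| < 1 by rewrite normrX exprn_ilt1.
have z0 : q ^+ 2 != 0 by rewrite expf_neq0.
have fE n : n%:~R * theta_term (q ^+ 3) (q ^+ 2) n = f n.
  by rewrite theta_termE // addrC.
have tf : tight f.
  have tt := @tight_theta R (q ^+ 3) (q ^+ 2) (fun n => n%:~R) p0 p1 z0.
  rewrite (_ : f = fun n => n%:~R * theta_term (q ^+ 3) (q ^+ 2) n).
    by apply: tt => k; rewrite normrMz normr1 -abszE ler_nat ltnW.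
  by apply/funext => n; rewrite fE.
have [bf hf] := tight_bisum tf; split; first exact: bf.
have hj := jacobi_triple_product p0 p1 z0.
rewrite (_ : q ^+ 3 / q ^+ 2 = q) in hj; last by rewrite (exprD q 1 2) mulfK.
have h6 := has_sumD (has_sumZ 6 hf) hj.
have := has_sum_unique (has_sum_6n1_theta hq0 hq1) (eq_has_sum _ h6).
move=> ->; last first.
  by move=> n; rewrite -fE rmorphD rmorphM /=; move: (theta_term _ _ _) => x; ring.
(* The triple product at z = q^2 lists the factor of z before that of q^3 / z = q. *)
rewrite (mulrC (qpoch (- q) (q ^+ 3)) (qpoch (- q ^+ 2) (q ^+ 3))).
exact: esym (addrK _ _).
Qed.
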